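(* Let $P(z)=z^3+az^2+bz+c$ be a complex polynomial whose three zeros $z_1,z_2,z_3\in\mathbb{C}$ are noncollinear, and let $T\subset\mathbb{C}$ be the triangle with vertices $z_1,z_2,z_3$. Then the zeros of $$ID_3(P)(u)=(a^2-3b)u^2+(ab-9c)u+b^2-3ac$$ are the first and second isodynamic points of $T$.
   Context: The isodynamic points of the triangle $T$ with vertices $z_1,z_2,z_3$ are the points $u\in\mathbb{C}$ whose distances to the vertices are inversely proportional to the lengths of the opposite sides, i.e. the solutions $u\in\mathbb{C}$ of $$|u-z_1|\,|z_3-z_2|=|u-z_2|\,|z_3-z_1|=|u-z_3|\,|z_2-z_1|.$$ A non-equilateral triangle has exactly two such points (the first and second isodynamic points). An equilateral triangle has just one in $\mathbb{C}$, the second being thought of as lying at infinity; in that case $ID_3(P)$ is linear. Up to a constant factor, $ID_3(P)(u)$ is the discriminant with respect to $z$ of the polar derivative $3P(z)+(u-z)P'(z)$. *)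

(* Defs.v *)
From HB Require Import structures.
From mathcomp Require Import all_boot all_order all_algebra.
From mathcomp Require Import complex reals.

Set Implicit Arguments.
Unset Strict Implicit.
Unset Printing Implicit Defensive.

Import Order.TTheory GRing.Theory Num.Theory.
Local Open Scope ring_scope.
Local Open Scope complex_scope.

Definition collinear (R : realType) (z1 z2 z3 : R[i]) : Prop :=
  exists p d : R[i], d <> 0 /\
    forall z : R[i], z \in [:: z1; z2; z3] -> exists t : R, z = p + t%:C * d.

(* The norm `|_| on R[i] is R[i]-valued; its values are nonnegative reals. *)
Definition isodynamic (R : realType) (z1 z2 z3 u : R[i]) : Prop :=
  `|u - z1| * `|z3 - z2| = `|u - z2| * `|z3 - z1| /\
  `|u - z2| * `|z3 - z1| = `|u - z3| * `|z2 - z1|.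

Definition equilateral (R : realType) (z1 z2 z3 : R[i]) : Prop :=
  `|z3 - z2| = `|z3 - z1| /\ `|z3 - z1| = `|z2 - z1|.

(* ID_3(P) for P = 'X^3 + a *: 'X^2 + b *: 'X + c%:P, as a polynomial in u. *)
Definition ID3 (R : realType) (a b c : R[i]) : {poly R[i]} :=
  (a ^+ 2 - 3 * b) *: 'X^2 + (a * b - 9 * c) *: 'X + (b ^+ 2 - 3 * a * c)%:P.

(* Main.v *)
Require Import Defs.
From HB Require Import structures.
From mathcomp Require Import all_boot all_order all_algebra.
From mathcomp Require Import complex reals.
From mathcomp Require Import ring.

Set Implicit Arguments.
Unset Strict Implicit.
Unset Printing Implicit Defensive.

Import Order.TTheory GRing.Theory Num.Theory.
Local Open Scope ring_scope.
Local Open Scope complex_scope.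

(** Put [A = (u - z1) * (z3 - z2)], [B = (u - z2) * (z1 - z3)] and
    [C = (u - z3) * (z2 - z1)].  Then [A + B + C = 0], and [u] is isodynamic
    exactly when [A], [B], [C] have the same modulus.  Three complex numbers of
    sum zero have the same modulus iff they form an equilateral triangle around
    the origin, i.e. iff [A ^+ 2 + A * B + B ^+ 2 = 0]
    ([eq_norm_sum0P]); this quadratic form in [A], [B] is [ID_3(P)(u)] once the
    coefficients of [P] are expressed through its zeros.

    The same criterion applied to the side vectors [z3 - z2], [z1 - z3],
    [z2 - z1], also of sum zero, shows that the leading coefficient of
    [ID_3(P)] vanishes exactly for equilateral triangles.  The discriminant of
    [ID_3(P)] is [-3] times that of [P], hence nonzero since the vertices are
    distinct: so there are two isodynamic points when the degree is two, and
    when the degree drops the linear coefficient is nonzero and there is just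
    one. *)

(** * Three complex numbers of equal modulus and sum zero *)

Lemma norm_eq_quad0 (C : numClosedFieldType) (x y : C) :
  x ^+ 2 + x * y + y ^+ 2 = 0 -> `|x| = `|y|.
Proof.
move=> xy0; apply/eqP; rewrite -(@eqrXn2 _ 3) // -!normrX; apply/eqP; congr `|_|.
apply/eqP; rewrite -subr_eq0; apply/eqP.
have -> : x ^+ 3 - y ^+ 3 = (x - y) * (x ^+ 2 + x * y + y ^+ 2) by ring.
by rewrite xy0 mulr0.
Qed.

(** The form [x ^+ 2 + x * y + y ^+ 2] is the product of [x - w * y] over the
    two primitive cube roots of unity [w], so it detects the two orientations
    of the equilateral triangle [x], [y], [- (x + y)].  For the direct
    implication, with [r] the common squared modulus, the cosine rule gives
    [x * y^* + x^* * y = - r], and multiplying by [x * y] turns this into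
    [r * (x ^+ 2 + x * y + y ^+ 2) = 0]. *)
Lemma eq_norm_sum0P (C : numClosedFieldType) (x y : C) :
  `|x| = `|y| /\ `|y| = `|x + y| <-> x ^+ 2 + x * y + y ^+ 2 = 0.
Proof.
split=> [[xy yz]|xy0]; last first.
  split; first exact: norm_eq_quad0.
  rewrite -(normrN (x + y)); apply: norm_eq_quad0.
  by rewrite -xy0; ring.
have Ey : y * y^* = x * x^* by rewrite -!normCK xy.
have Ez : (x + y) * (x^* + y^*) = x * x^* by rewrite -rmorphD -!normCK -yz xy.
have : (x * x^*) * (x ^+ 2 + x * y + y ^+ 2) = 0.
  have -> : (x * x^*) * (x ^+ 2 + x * y + y ^+ 2) =
      x * y * ((x + y) * (x^* + y^*) - x * x^*)
      - (x ^+ 2 + x * y) * (y * y^* - x * x^*) by ring.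
  by rewrite Ez Ey !subrr !mulr0 subr0.
move=> /eqP; rewrite mulf_eq0 -normCK expf_eq0 /= normr_eq0.
case/orP=> [/eqP x0|/eqP //].
by move: xy; rewrite x0 normr0 => /esym/eqP; rewrite normr_eq0 => /eqP ->; ring.
Qed.

(** * Polynomials of degree at most two *)

Section Quadratic.
Variable C : numClosedFieldType.
Implicit Types p q r u : C.

Lemma horner_quadratic p q r u :
  (p *: 'X^2 + q *: 'X + r%:P).[u] = p * u ^+ 2 + q * u + r.
Proof. by rewrite !hornerE. Qed.

Lemma size_linear q r : q != 0 -> size (q *: 'X + r%:P) = 2%N.
Proof.
move=> q0; rewrite size_polyDl size_scale ?size_polyX //.
exact: leq_ltn_trans (size_polyC_leq1 r) _.
Qed.

Lemma size_quadratic p q r :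
  p != 0 -> size (p *: 'X^2 + q *: 'X + r%:P) = 3%N.
Proof.
move=> p0; rewrite -addrA size_polyDl size_scale ?size_polyXn //.
rewrite (leq_ltn_trans (size_polyD _ _)) // gtn_max.
rewrite (leq_ltn_trans (size_scale_leq _ _)) ?size_polyX //=.
exact: leq_ltn_trans (size_polyC_leq1 r) _.
Qed.

Lemma quadratic_two_roots p q r :
    p != 0 -> q ^+ 2 - 4 * p * r != 0 ->
  exists u1 u2 : C, u1 <> u2 /\
    forall u, p * u ^+ 2 + q * u + r = 0 <-> u = u1 \/ u = u2.
Proof.
set D := _ - _ => p0 D0.
have s2 : sqrtC D ^+ 2 = D by rewrite sqrtCK.
have s0 : sqrtC D != 0 by rewrite sqrtC_eq0.
move: (sqrtC D) s2 s0 => s s2 s0.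
exists ((- q + s) / (2 * p)), ((- q - s) / (2 * p)); split=> [u12|u].
  have : s = p * ((- q + s) / (2 * p) - (- q - s) / (2 * p)) by field.
  by rewrite u12 subrr mulr0; apply/eqP.
have fact : p * u ^+ 2 + q * u + r =
    p * (u - (- q + s) / (2 * p)) * (u - (- q - s) / (2 * p)).
  have -> : r = (q ^+ 2 - s ^+ 2) / (4 * p) by rewrite s2 /D; field.
  by field.
rewrite fact; split=> [/eqP|[] ->]; last 2 first.
- by rewrite subrr mulr0 mul0r.
- by rewrite subrr mulr0.
rewrite !mulf_eq0 (negPf p0) /= !subr_eq0.
by case/orP=> /eqP; [left | right].
Qed.

End Quadratic.

(** * The triangle *)

Lemma monic_cubic_Vieta (C : numFieldType) (a b c z1 z2 z3 : C) :
    'X^3 + a *: 'X^2 + b *: 'X + c%:P =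
      ('X - z1%:P) * ('X - z2%:P) * ('X - z3%:P) ->
  [/\ a = - (z1 + z2 + z3), b = z1 * z2 + z2 * z3 + z3 * z1
    & c = - (z1 * z2 * z3)].
Proof.
move=> eqP.
have ev x : x ^+ 3 + a * x ^+ 2 + b * x + c = (x - z1) * (x - z2) * (x - z3).
  by have := congr1 (horner^~ x) eqP; rewrite !hornerE.
have Ec : c = - (z1 * z2 * z3).
  transitivity (0 ^+ 3 + a * 0 ^+ 2 + b * 0 + c); first by ring.
  by rewrite ev; ring.
have E1 := ev 1; have E2 := ev (-1).
split=> //.
- have -> : a = ((1 ^+ 3 + a * 1 ^+ 2 + b * 1 + c)
     + ((-1) ^+ 3 + a * (-1) ^+ 2 + b * (-1) + c)) / 2 - c by field.
  by rewrite E1 E2 Ec; field.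
- have -> : b = ((1 ^+ 3 + a * 1 ^+ 2 + b * 1 + c)
     - ((-1) ^+ 3 + a * (-1) ^+ 2 + b * (-1) + c)) / 2 - 1 by field.
  by rewrite E1 E2; field.
Qed.

Section Triangle.
Variable R : realType.
Implicit Types z u : R[i].

Lemma collinear_eq12 z1 z2 z3 : z1 = z2 -> collinear z1 z2 z3.
Proof.
move=> <-; have [->|z31] := eqVneq z3 z1.
  exists z1, 1; split=> [|z]; first by apply/eqP; rewrite oner_eq0.
  by rewrite !inE => /or3P[]/eqP->; exists 0; rewrite mul0r addr0.
exists z1, (z3 - z1); split=> [|z]; first by apply/eqP; rewrite subr_eq0.
rewrite !inE => /or3P[]/eqP->; [exists 0|exists 0|exists 1].
- by rewrite mul0r addr0.
- by rewrite mul0r addr0.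
- by rewrite mul1r addrC subrK.
Qed.

Lemma collinear_rot z1 z2 z3 : collinear z1 z2 z3 -> collinear z2 z3 z1.
Proof.
case=> p [d [d0 H]]; exists p, d; split=> // z zin; apply: H.
by move: zin; rewrite !inE => /or3P[]->; rewrite ?orbT.
Qed.

Lemma noncollinear_neq z1 z2 z3 :
  ~ collinear z1 z2 z3 -> [/\ z1 != z2, z2 != z3 & z3 != z1].
Proof.
move=> ncol; split; apply/eqP => /collinear_eq12 col; apply: ncol.
- exact: col.
- exact/collinear_rot/collinear_rot/col.
- exact/collinear_rot/col.
Qed.

Lemma isodynamic_quadP z1 z2 z3 u :
  let x := (u - z1) * (z3 - z2) in let y := (u - z2) * (z1 - z3) in
  isodynamic z1 z2 z3 u <-> x ^+ 2 + x * y + y ^+ 2 = 0.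
Proof.
move=> x y; rewrite -eq_norm_sum0P /isodynamic.
have -> : x + y = - ((u - z3) * (z2 - z1)) by rewrite /x /y; ring.
by rewrite normrN !normrM (distrC z1 z3).
Qed.

Lemma equilateral_quadP z1 z2 z3 :
  let x := z3 - z2 in let y := z1 - z3 in
  equilateral z1 z2 z3 <-> x ^+ 2 + x * y + y ^+ 2 = 0.
Proof.
move=> x y; rewrite -eq_norm_sum0P /equilateral.
have -> : x + y = - (z2 - z1) by rewrite /x /y; ring.
by rewrite normrN (distrC z1 z3).
Qed.

End Triangle.

Theorem proposition10 (R : realType) (P : {poly R[i]}) (a b c z1 z2 z3 : R[i])
  (P_coefs : P = 'X^3 + a *: 'X^2 + b *: 'X + c%:P)
  (P_zeros : P = ('X - z1%:P) * ('X - z2%:P) * ('X - z3%:P))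
  (T_nondegenerate : ~ collinear z1 z2 z3) :
  [/\ forall u : R[i], root (ID3 a b c) u <-> isodynamic z1 z2 z3 u,
      ~ equilateral z1 z2 z3 ->
        size (ID3 a b c) = 3%N /\
        exists u1 u2 : R[i], u1 <> u2 /\
          forall u : R[i], isodynamic z1 z2 z3 u <-> u = u1 \/ u = u2
    & equilateral z1 z2 z3 ->
        size (ID3 a b c) = 2%N /\ exists! u : R[i], isodynamic z1 z2 z3 u].
Proof.
have [z12 z23 z31] := noncollinear_neq T_nondegenerate.
have [Ea Eb Ec] := monic_cubic_Vieta (etrans (esym P_coefs) P_zeros).
rewrite /ID3; set p := a ^+ 2 - 3 * b; set q := a * b - 9 * c.
set r := b ^+ 2 - 3 * a * c.
have isoP u : isodynamic z1 z2 z3 u <-> p * u ^+ 2 + q * u + r = 0.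
  rewrite isodynamic_quadP /= /p /q /r Ea Eb Ec.
  by split=> <-; ring.
have equiP : equilateral z1 z2 z3 <-> p = 0.
  by rewrite equilateral_quadP /= /p Ea Eb; split=> <-; ring.
(* The form [x ^+ 2 + x * y + y ^+ 2] has discriminant [-3]; substituting the
   affine functions [x], [y] of [u] multiplies it by the square of the
   determinant of their coefficients, which is the product of differences. *)
have discE : q ^+ 2 - 4 * p * r =
    - 3 * ((z1 - z2) * (z2 - z3) * (z3 - z1)) ^+ 2.
  by rewrite /p /q /r Ea Eb Ec; ring.
have disc0 : q ^+ 2 - 4 * p * r != 0.
  by rewrite discE !mulf_neq0 ?expf_neq0 ?oppr_eq0 ?pnatr_eq0 ?mulf_neq0
             ?subr_eq0.
split=> [u|nequi|/equiP p0].
- by rewrite isoP rootE horner_quadratic; split=> /eqP.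
- have p0 : p != 0 by apply/eqP => /equiP.
  split; first exact: size_quadratic.
  have [u1 [u2 [u12 H]]] := quadratic_two_roots p0 disc0.
  by exists u1, u2; split=> // u; rewrite isoP.
have q0 : q != 0.
  by move: disc0; rewrite p0 mulr0 mul0r subr0 expf_eq0.
split; first by rewrite p0 scale0r add0r size_linear.
exists (- r / q); split=> [|u /isoP]; first by apply/isoP; rewrite p0; field.
rewrite p0 mul0r add0r => H.
have -> : - r / q = u - (q * u + r) / q by field.
by rewrite H mul0r subr0.
Qed.
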